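(* Let $\phi\in\widetilde{M}$ and let $(V,\nu,\tau,\tau^{*})$ be a characteristic $\phi$-Šerstnev PN space. If a nonempty subset $A\subseteq V$ is D-compact, then $A$ is D-bounded and $A$ is closed in the strong topology of $V$.
   Context: **Distribution functions.** $\Delta^{+}$ is the set of functions $F:\mathbb{R}\cup\{+\infty\}\to[0,1]$ that are non-decreasing, left-continuous on $\mathbb{R}$, with $F(0)=0$ and $F(+\infty)=1$. Write $l^{-}F(x)$ for the left limit of $F$ at $x$, so $l^{-}F(+\infty)=\lim_{x\to+\infty}F(x)$. $D^{+}=\{F\in\Delta^{+}: l^{-}F(+\infty)=1\}$. $\Delta^{+}$ is ordered pointwise; its maximal element is $\varepsilon_0$, with $\varepsilon_0(x)=0$ for $x\le 0$ and $\varepsilon_0(x)=1$ for $x>0$. **Triangle functions.** A triangle function is a binary operation $\tau:\Delta^{+}\times\Delta^{+}\to\Delta^{+}$ that is associative, commutative, non-decreasing in each argument, and has $\varepsilon_0$ as unit. Continuity of a triangle function is with respect to the topology of weak convergence on $\Delta^{+}$ (convergence at continuity points in $\mathbb{R}$ of the limit). **PN spaces.** A probabilistic normed (PN) space is a quadruple $(V,\nu,\tau,\tau^{*})$ where $V$ is a real vector space with null vector $\theta$, $\tau,\tau^{*}$ are continuous triangle functions, and $\nu:V\to\Delta^{+}$, $p\mapsto\nu_p$, satisfies for all $p,q\in V$: (N1) $\nu_p=\varepsilon_0$ iff $p=\theta$; (N2) $\nu_{-p}=\nu_p$; (N3) $\nu_{p+q}\ge\tau(\nu_p,\nu_q)$;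 (N4) $\nu_p\le\tau^{*}(\nu_{\alpha p},\nu_{(1-\alpha)p})$ for all $\alpha\in[0,1]$. It is called characteristic if $\nu_p\in D^{+}$ for all $p\in V$. **$\phi$-Šerstnev spaces.** $\widetilde{M}$ is the set of non-decreasing left-continuous functions $\phi:[0,+\infty]\to[0,+\infty]$ with $\phi(0)=0$, $\phi(+\infty)=+\infty$ and $\phi(x)>0$ for $x>0$. For $\phi\in\widetilde{M}$, its left-continuous quasi-inverse $\hat\phi$ is defined by $\hat\phi(0)=0$, $\hat\phi(+\infty)=+\infty$, $\hat\phi(t)=\sup\{u:\phi(u)<t\}$ for $0<t<+\infty$. A PN space is a $\phi$-Šerstnev PN space if $\nu_{\lambda p}(x)=\nu_p\big(\hat\phi(\phi(x)/|\lambda|)\big)$ for all $x\in\mathbb{R}^{+}$, $p\in V$, $\lambda\in\mathbb{R}\setminus\{0\}$. **Strong topology.** For $p\in V$, $\lambda>0$, let $N_p(\lambda)=\{q\in V:\nu_{p-q}(\lambda)>1-\lambda\}$. The sets $N_p(\lambda)$, $\lambda>0$, form the strong neighborhood system at $p$, which determines a Hausdorff topology on $V$ (the strong topology). A sequence $\{p_n\}$ converges (strongly) to $p$ if for each $\lambda>0$ there is $N$ with $p_n\in N_p(\lambda)$ for all $n\ge N$. **D-bounded sets.** For nonempty $A\subseteq V$, the probabilistic radius $R_A$ is defined by letting $R_A(x)$, for $x\in[0,+\infty)$, be the left limit at $x$ of the function $t\mapsto\inf\{\nu_p(t):p\in A\}$, and $R_A(+\infty)=1$. $A$ is D-bounded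 if $R_A\in D^{+}$, i.e. $\lim_{x\to+\infty}R_A(x)=1$. **D-compact sets.** A subset $A$ of a characteristic $\phi$-Šerstnev PN space is D-compact if every sequence in $A$ has a subsequence that converges strongly to an element of $A$. *)

(* Defs.v *)
From HB Require Import structures.
From mathcomp Require Import all_boot all_order all_algebra.
From mathcomp Require Import all_classical all_reals all_analysis.
From mathcomp Require Import lra.
Set Implicit Arguments.
Unset Strict Implicit.
Unset Printing Implicit Defensive.
Import Order.TTheory GRing.Theory Num.Theory.
Import numFieldNormedType.Exports.
Local Open Scope classical_set_scope.
Local Open Scope ring_scope.

(* Members of Delta^+ are functions on R u {+oo}; they are represented on
   \bar R, where monotonicity, 0 <= F and F 0 = 0 force F -oo = 0, so that the
   extra point carries no information and equality is not affected. *)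
Record Delta_plus (R : realType) (F : \bar R -> R) : Prop := {
  Delta_plus_ge0 : forall x, 0 <= F x ;
  Delta_plus_le1 : forall x, F x <= 1 ;
  Delta_plus_homo : {homo F : x y / (x <= y)%E >-> x <= y} ;
  Delta_plus_left : forall x : R, F t%:E @[t --> x^'-] --> F x%:E ;
  Delta_plus_at0 : F 0%E = 0 ;
  Delta_plus_aty : F +oo%E = 1 }.

Definition D_plus (R : realType) (F : \bar R -> R) : Prop :=
  Delta_plus F /\ F t%:E @[t --> +oo] --> (1 : R).

Record distf (R : realType) := Distf {
  distf_fun :> \bar R -> R ;
  distfP : Delta_plus distf_fun }.

Section distf_choice.
Variable R : realType.
HB.instance Definition _ := gen_eqMixin (distf R).
HB.instance Definition _ := gen_choiceMixin (distf R).
End distf_choice.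

Lemma distf_eq (R : realType) (F G : distf R) : F =1 G -> F = G.
Proof.
case: F G => [f fP] [g gP] /= /funext fg; subst g.
by congr Distf; exact: Prop_irrelevance.
Qed.

Definition distf_le (R : realType) (F G : distf R) : Prop :=
  forall x, F x <= G x.

Definition continuity_point (R : realType) (F : distf R) (x : R) : Prop :=
  F t%:E @[t --> x] --> F x%:E.

Definition eps0_fun (R : realType) (x : \bar R) : R := (0 < x)%E%:R.

Lemma eps0_subproof (R : realType) : Delta_plus (@eps0_fun R).
Proof.
rewrite /eps0_fun; split.
- by move=> x; rewrite ler0n.
- by move=> x; rewrite lern1; case: (0 < x)%E.
- move=> x y xy; rewrite ler_nat; case: (ltP 0%E x) => //= x0.
  by rewrite (lt_le_trans x0 xy).
- move=> x; have [x0|x0] := ltP 0 x; apply: cvg_near_cst; near=> t.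
    have t0 : 0 < t by near: t; exact: nbhs_left_gt.
    by rewrite !lte_fin x0 t0.
  have tx : t <= x by near: t; exact: nbhs_left_le.
  by rewrite !lte_fin !ltNge x0 (le_trans tx x0).
- by rewrite ltxx.
- by rewrite ltry.
Unshelve. all: by end_near. Qed.

Definition eps0 (R : realType) : distf R := Distf (@eps0_subproof R).

(* The topology of weak convergence: a basic neighborhood of F constrains
   finitely many continuity points of F in R. *)
Definition weak_nbhd (R : realType) (F : distf R) (se : seq R * R) :
    set (distf R) :=
  [set G | forall x, x \in se.1 -> `|G x%:E - F x%:E| < se.2].

Definition weak_nbhs (R : realType) (F : distf R) : set_system (distf R) :=
  filter_from
    [set se : seq R * R |
      (forall x, x \in se.1 -> continuity_point F x) /\ 0 < se.2]
    (weak_nbhd F).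

HB.instance Definition _ (R : realType) :=
  hasNbhs.Build (distf R) (@weak_nbhs R).

Section weak_topology.
Variable R : realType.
Implicit Types F G : distf R.

Lemma continuity_point_dense F (a b : R) :
  a < b -> exists2 x, a < x < b & continuity_point F x.
Proof.
move=> ab; pose f (t : R) := F t%:E.
have fh : {homo f : x y / x <= y}.
  by move=> x y xy; apply: (Delta_plus_homo (distfP F)); rewrite lee_fin.
have cD := @discontinuity_countable R a b f (in2W fh).
apply: contrapT => nx.
have : lebesgue_measure (`]a, b[%classic : set R) = 0%E.
  apply: (@countable_lebesgue_measure0 R); apply: sub_countable cD.
  apply: subset_card_le => x /= xab; split => //.
  have xab' : a < x < b by move: xab; rewrite in_itv.
  have [ax xb] := andP xab'.
  have fl : f t @[t --> x^'-] --> f x := Delta_plus_left (distfP F) (x := x).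
  have cr : cvg (f t @[t --> x^'+]).
    apply: nondecreasing_at_right_is_cvgr.
      by near=> y; apply: in2W.
    near=> y; exists 0 => _ [t _ <-]; exact: (Delta_plus_ge0 (distfP F)).
  split => //; first by apply/cvg_ex; exists (f x).
  apply/eqP => lr; apply: nx; exists x => //.
  apply/left_right_continuousP; split => //.
  have fr : lim (f t @[t --> x^'+]) = f x.
    by rewrite -lr; exact: cvg_lim fl.
  by rewrite -[F x%:E]fr.
rewrite lebesgue_measure_itv /= lte_fin ab => /eqP.
by rewrite -EFinB eqe subr_eq0 gt_eqF.
Unshelve. all: by end_near. Qed.

Lemma weak_nbhs_filter F : ProperFilter (weak_nbhs F).
Proof.
apply: filter_from_proper; last first.
  by move=> [s e] [_ e0]; exists F => x _ /=; rewrite subrr normr0.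
apply: filter_from_filter; first by exists ([::], 1).
move=> [s e] [s' e'] [/= sF e0] [/= sF' e'0].
exists (s ++ s', Num.min e e'); rewrite /weak_nbhd /=.
  split; last by rewrite lt_min e0.
  by move=> x; rewrite mem_cat => /orP[/sF|/sF'].
move=> G /= GF; split=> x xs /=.
  by have := GF x; rewrite mem_cat xs lt_min => /(_ isT)/andP[].
by have := GF x; rewrite mem_cat xs orbT lt_min => /(_ isT)/andP[].
Qed.

Lemma weak_nbhs_singleton F (A : set (distf R)) : weak_nbhs F A -> A F.
Proof.
by move=> [[s e] [_ e0]]; apply=> x _ /=; rewrite subrr normr0.
Qed.

Lemma weak_nbhs1 F (x e : R) : continuity_point F x -> 0 < e ->
  weak_nbhs F [set G | `|G x%:E - F x%:E| < e].
Proof.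
move=> Fx e0; exists ([:: x], e).
  by split=> // y; rewrite inE => /eqP ->.
by move=> G /= /(_ x); rewrite /= inE eqxx; apply.
Qed.

Lemma weak_nbhs_nbhs F (A : set (distf R)) :
  weak_nbhs F A -> weak_nbhs F (@weak_nbhs R ^~ A).
Proof.
have flt G : Filter (weak_nbhs G) by case: (weak_nbhs_filter G).
suff one x e : continuity_point F x -> 0 < e ->
    weak_nbhs F (@weak_nbhs R ^~ [set G | `|G x%:E - F x%:E| < e]).
  move=> [[s e] [/= sF e0] sA].
  have : weak_nbhs F (@weak_nbhs R ^~ (weak_nbhd F (s, e))).
    elim: s sF {sA} => [_|x s ih sF].
      by apply: (@filterE _ (weak_nbhs F)) => G; apply: (@filterE _ (weak_nbhs G)).
    have h1 := one x e (sF x (mem_head _ _)) e0.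
    have h2 : weak_nbhs F (@weak_nbhs R ^~ (weak_nbhd F (s, e))).
      by apply: ih => y ys; apply: sF; rewrite inE ys orbT.
    apply: (@filterS2 _ (weak_nbhs F) (flt F) _ _ _ _ h1 h2) => G.
    apply: (@filterS2 _ (weak_nbhs G) (flt G)) => H Hx Hs y /=.
    by rewrite inE => /orP[/eqP ->//|/Hs].
  apply: (@filterS _ (weak_nbhs F)) => G.
  exact: (@filterS _ (weak_nbhs G)).
move=> Fx e0; pose d := e / 4.
have d0 : 0 < d by rewrite divr_gt0.
have [r /= r0 rF] : exists2 r : R, 0 < r &
    forall t : R, `|x - t| < r -> `|F x%:E - F t%:E| < d.
  have /cvgrPdist_lt/(_ d d0) := Fx.
  by move=> [r /= r0 rF]; exists r => // t xt; apply: rF.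
have [a /andP[xa ax] Fa] :=
  continuity_point_dense F (ltac:(by rewrite gtrBl) : x - r < x).
have [b /andP[xb bx] Fb] :=
  continuity_point_dense F (ltac:(by rewrite ltrDl) : x < x + r).
have Fxa : `|F x%:E - F a%:E| < d.
  by apply: rF; rewrite gtr0_norm ?subr_gt0 // ltrBlDr -ltrBlDl.
have Fxb : `|F x%:E - F b%:E| < d.
  by apply: rF; rewrite ltr0_norm ?subr_lt0 // opprB ltrBlDl.
apply: (@filterS2 _ (weak_nbhs F) (flt F) _ _ _ _
  (weak_nbhs1 Fa d0) (weak_nbhs1 Fb d0)) => G /= Ga Gb.
have [a' /andP[aa' a'x] Ga'] := continuity_point_dense G ax.
have [b' /andP[xb' b'b] Gb'] := continuity_point_dense G xb.
apply: (@filterS2 _ (weak_nbhs G) (flt G) _ _ _ _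
  (weak_nbhs1 Ga' d0) (weak_nbhs1 Gb' d0)) => H /= Ha' Hb'.
have mono (K : distf R) (s t : R) : s < t -> K s%:E <= K t%:E.
  by move=> st; apply: (Delta_plus_homo (distfP K)); rewrite lee_fin ltW.
have := (mono H _ _ a'x, mono H _ _ xb', mono G _ _ aa', mono G _ _ b'b).
move=> [[[h1 h2] h3] h4].
move: Ga Gb Ha' Hb' Fxa Fxb; rewrite !ltr_norml.
move=> /andP[? ?] /andP[? ?] /andP[? ?] /andP[? ?] /andP[? ?] /andP[? ?].
have e4 : e = d + d + d + d by rewrite /d; lra.
by apply/andP; split; lra.
Qed.

HB.instance Definition _ := Nbhs_isNbhsTopological.Build (distf R)
  weak_nbhs_filter weak_nbhs_singleton weak_nbhs_nbhs.

Lemma cvg_distfP (F_ : nat -> distf R) F :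
  F_ n @[n --> \oo] --> F <->
  forall x : R, continuity_point F x -> F_ n x%:E @[n --> \oo] --> F x%:E.
Proof.
split=> [FF x Fx|FF A [[s e] [/= sF e0] sA]].
  apply/cvgrPdist_lt => e e0.
  have /FF FA : nbhs F [set G | `|G x%:E - F x%:E| < e] by exact: weak_nbhs1.
  by near=> n; rewrite distrC; near: n.
suff : \forall n \near \oo, weak_nbhd F (s, e) (F_ n).
  by move=> FA; near=> n => /=; apply: sA; near: n.
elim: s sF {sA} => [_|x s ih sF]; first by apply: nearW.
have h1 : \forall n \near \oo, `|F x%:E - F_ n x%:E| < e.
  by have /cvgrPdist_lt := FF x (sF x (mem_head _ _)); apply.
have h2 : \forall n \near \oo, weak_nbhd F (s, e) (F_ n).
  by apply: ih => y ys; apply: sF; rewrite inE ys orbT.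
near=> n => y /=; rewrite inE => /orP[/eqP ->|ys].
  by rewrite distrC; near: n.
suff /(_ _ ys) : weak_nbhd F (s, e) (F_ n) by [].
by near: n.
Unshelve. all: by end_near. Qed.

Lemma nbhs_eps0 (A : set (distf R)) : nbhs (eps0 R) A ->
  exists2 m : R, 0 < m & forall F, F m%:E > 1 - m -> A F.
Proof.
move=> [[s e] [/= sF e0] sA].
suff [m /andP[m0 me] ms] : exists2 m : R, 0 < m < e &
    forall x, x \in s -> 0 < x -> m <= x.
  exists m => // F Fm; apply: sA => x xs /=.
  rewrite /eps0_fun lte_fin; have [x0|x0] := ltP 0 x; rewrite ?mulr1n ?mulr0n.
    have Fx : F m%:E <= F x%:E.
      by apply: (Delta_plus_homo (distfP F)); rewrite lee_fin ms.
    have := Delta_plus_le1 (distfP F) x%:E.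
    by rewrite ltr_norml => ?; apply/andP; split; lra.
  have : F x%:E <= F 0%E.
    by apply: (Delta_plus_homo (distfP F)); rewrite lee_fin.
  rewrite (Delta_plus_at0 (distfP F)).
  have := Delta_plus_ge0 (distfP F) x%:E.
  by rewrite ltr_norml => ? ?; apply/andP; split; lra.
elim: s {sF sA} => [|x s [m /andP[m0 me] ih]].
  by exists (e / 2) => //; rewrite divr_gt0 //= ltr_pdivrMr // ltr_pMr // ltr1n.
have [x0|x0] := ltP 0 x; last first.
  exists m => [|y]; first by rewrite m0.
  by rewrite inE => /orP[/eqP ->|/ih//]; rewrite ltNge x0.
exists (Num.min m x) => [|y].
  by rewrite lt_min m0 x0 gt_min me.
rewrite inE => /orP[/eqP ->|ys y0]; first by rewrite ge_min lexx orbT.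
by rewrite ge_min ih.
Qed.

End weak_topology.

Record triangle_function (R : realType) (tau : distf R -> distf R -> distf R) :
    Prop := {
  triangleA : associative tau ;
  triangleC : commutative tau ;
  triangle_homol : forall H F G,
    distf_le F G -> distf_le (tau F H) (tau G H) ;
  triangle_homor : forall H F G,
    distf_le F G -> distf_le (tau H F) (tau H G) ;
  triangle1f : left_id (eps0 R) tau ;
  trianglef1 : right_id (eps0 R) tau }.

Definition continuous_triangle_function (R : realType)
    (tau : distf R -> distf R -> distf R) : Prop :=
  triangle_function tau /\
  continuous (fun FG : distf R * distf R => tau FG.1 FG.2).

Record pnSpace (R : realType) := PNSpace {
  pn_sort :> lmodType R ;
  pn_nu : pn_sort -> distf R ;
  pn_tau : distf R -> distf R -> distf R ;
  pn_taustar : distf R -> distf R -> distf R ;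
  pn_tauP : continuous_triangle_function pn_tau ;
  pn_taustarP : continuous_triangle_function pn_taustar ;
  pn_N1 : forall p, pn_nu p = eps0 R <-> p = 0 ;
  pn_N2 : forall p, pn_nu (- p) = pn_nu p ;
  pn_N3 : forall p q,
    distf_le (pn_tau (pn_nu p) (pn_nu q)) (pn_nu (p + q)) ;
  pn_N4 : forall p (a : R), 0 <= a <= 1 ->
    distf_le (pn_nu p) (pn_taustar (pn_nu (a *: p)) (pn_nu ((1 - a) *: p))) }.

Definition characteristic (R : realType) (V : pnSpace R) : Prop :=
  forall p : V, D_plus (pn_nu p).

(* Functions [0, +oo] -> [0, +oo] are represented on \bar R; only their values
   at arguments x >= 0 are constrained or used.  Left continuity is required at
   finite points, the value at +oo being fixed by convention as in Delta^+. *)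
Record Mtilde (R : realType) (phi : \bar R -> \bar R) : Prop := {
  Mtilde_ge0 : forall x, (0 <= x)%E -> (0 <= phi x)%E ;
  Mtilde_homo : forall x y, (0 <= x)%E -> (x <= y)%E -> (phi x <= phi y)%E ;
  Mtilde_left : forall x : R, 0 < x -> phi t%:E @[t --> x^'-] --> phi x%:E ;
  Mtilde_at0 : phi 0%E = 0%E ;
  Mtilde_aty : phi +oo%E = +oo%E ;
  Mtilde_gt0 : forall x, (0 < x)%E -> (0 < phi x)%E }.

Definition quasi_inverse (R : realType) (phi : \bar R -> \bar R)
    (t : \bar R) : \bar R :=
  if t == 0%E then 0%E
  else if t == +oo%E then +oo%E
  else ereal_sup [set u | (0 <= u)%E /\ (phi u < t)%E].

Definition phi_Serstnev (R : realType) (phi : \bar R -> \bar R)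
    (V : pnSpace R) : Prop :=
  forall (x : R) (p : V) (l : R), 0 <= x -> l != 0 ->
    pn_nu (l *: p) x%:E =
    pn_nu p (quasi_inverse phi (phi x%:E * (`|l|^-1)%:E)%E).

(* The strong neighborhood N_p(l). *)
Definition strong_nbhd (R : realType) (V : pnSpace R) (p : V) (l : R) : set V :=
  [set q | pn_nu (p - q) l%:E > 1 - l].

(* The vectors of V with the strong topology. *)
Definition strong (R : realType) (V : pnSpace R) : Type := V.

Definition strong_nbhs (R : realType) (V : pnSpace R) (p : strong V) :
    set_system (strong V) :=
  filter_from [set l : R | 0 < l] (@strong_nbhd R V p).

HB.instance Definition _ (R : realType) (V : pnSpace R) :=
  Choice.copy (strong V) (pn_sort V).
HB.instance Definition _ (R : realType) (V : pnSpace R) :=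
  hasNbhs.Build (strong V) (@strong_nbhs R V).

Section strong_topology.
Variables (R : realType) (V : pnSpace R).

Lemma strong_nbhd_refl (p : V) (l : R) : 0 < l -> strong_nbhd p l p.
Proof.
move=> l0; rewrite /strong_nbhd /= subrr (proj2 (pn_N1 (0 : V)) erefl) /=.
by rewrite /eps0_fun lte_fin l0 ltrBlDr ltrDl.
Qed.

Lemma strong_nbhd_homo (p : V) (l m : R) :
  l <= m -> strong_nbhd p l `<=` strong_nbhd p m.
Proof.
move=> lm q; rewrite /strong_nbhd /= => pq.
apply: le_lt_trans (lt_le_trans pq _); first by rewrite lerD2l lerN2.
by apply: (Delta_plus_homo (distfP _)); rewrite lee_fin.
Qed.

Lemma strong_nbhs_filter (p : strong V) : ProperFilter (strong_nbhs p).
Proof.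
apply: filter_from_proper; last first.
  by move=> l l0; exists p; exact: strong_nbhd_refl.
apply: filter_from_filter; first by exists 1 => /=.
move=> l m /= l0 m0; exists (Num.min l m); first by rewrite /= lt_min l0.
by move=> q pq; split; apply: strong_nbhd_homo pq; rewrite ge_min lexx ?orbT.
Qed.

Lemma strong_nbhs_singleton (p : strong V) (A : set (strong V)) :
  strong_nbhs p A -> A p.
Proof. by move=> [l l0]; apply; exact: strong_nbhd_refl. Qed.

Lemma strong_nbhs_nbhs (p : strong V) (A : set (strong V)) :
  strong_nbhs p A -> strong_nbhs p (@strong_nbhs R V ^~ A).
Proof.
move=> [l /= l0 plA]; exists l => // q pq.
suff [m m0 qp] : exists2 m : R, 0 < m &
    (strong_nbhd (q : V) m `<=` strong_nbhd (p : V) l).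
  by exists m => // r /qp /plA.
set F := pn_nu ((p : V) - (q : V)).
have Fl : 1 - l < F l%:E by exact: pq.
have [a al Fa] : exists2 a : R, a < l & forall t, a < t < l -> 1 - l < F t%:E.
  have := Delta_plus_left (distfP F) (x := l).
  move=> /cvgrPdist_lt/(_ (F l%:E - (1 - l))).
  rewrite subr_gt0 => /(_ Fl) [e /= e0 Fe].
  exists (l - e) => [|t /andP[lt tl]]; first by rewrite gtrBl.
  have := Fe t; rewrite /= gtr0_norm ?subr_gt0 // ltrBlDr -ltrBlDl => /(_ lt tl).
  by rewrite ltr_norml => /andP[? ?]; lra.
have [x /andP[ax xl] Fx] := continuity_point_dense F al.
have {}Fa := Fa _ (ltac:(by rewrite ax xl) : a < x < l).
have := (pn_tauP V).2 (F, eps0 R).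
move=> /(_ [set G | `|G x%:E - F x%:E| < F x%:E - (1 - l)]).
rewrite /= (trianglef1 (pn_tauP V).1) => /(_ (weak_nbhs1 Fx _)).
rewrite subr_gt0 => /(_ Fa) [[B C] /= [FB e0C] BC].
have [m m0 mC] := nbhs_eps0 e0C.
exists m => // r qr; rewrite /strong_nbhd /=.
have -> : (p : V) - r = ((p : V) - (q : V)) + ((q : V) - r).
  by rewrite addrA subrK.
have := BC (F, pn_nu ((q : V) - r)).
move=> /(_ (conj (nbhs_singleton FB) (mC _ qr))) /=.
rewrite ltr_norml => /andP[h _].
have h1 : 1 - l < pn_tau V F (pn_nu ((q : V) - r)) x%:E by lra.
have h2 := pn_N3 ((p : V) - (q : V)) ((q : V) - r) l%:E.
apply: lt_le_trans h1 (le_trans _ h2).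
by apply: (Delta_plus_homo (distfP _)); rewrite lee_fin ltW.
Qed.

HB.instance Definition _ := Nbhs_isNbhsTopological.Build (strong V)
  strong_nbhs_filter strong_nbhs_singleton strong_nbhs_nbhs.

Lemma cvg_strongP (u : nat -> strong V) (p : strong V) :
  u n @[n --> \oo] --> p <->
  forall l : R, 0 < l ->
    exists N, forall n, (N <= n)%N -> strong_nbhd (p : V) l (u n).
Proof.
split=> [up l l0|up A [l /= l0 sA]].
  have : nbhs p (strong_nbhd (p : V) l) by exists l.
  by move=> /up [N _ uN]; exists N => n Nn; exact: uN.
have [N uN] := up l l0.
by exists N => // n /= Nn; apply/sA/uN.
Qed.

End strong_topology.

Definition inf_nu (R : realType) (V : pnSpace R) (A : set V) (t : R) : R :=
  inf [set pn_nu p t%:E | p in A].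

(* The left limit at x = 0 is taken over negative t, where every nu_p vanishes. *)
Definition prob_radius (R : realType) (V : pnSpace R) (A : set V)
    (x : \bar R) : R :=
  match x with
  | r%:E => lim (inf_nu A t @[t --> r^'-])
  | +oo%E => 1
  | -oo%E => 0
  end.

Definition D_bounded (R : realType) (V : pnSpace R) (A : set V) : Prop :=
  D_plus (prob_radius A).

Definition D_compact (R : realType) (V : pnSpace R) (A : set V) : Prop :=
  forall u : nat -> strong V, (forall n, A (u n)) ->
    exists (s : nat -> nat) (p : strong V),
      [/\ {homo s : m n / (m < n)%N}, A p & u (s n) @[n --> \oo] --> p].

(* Main.v *)
Require Import Defs.
From mathcomp Require Import all_boot all_order all_algebra.
From mathcomp Require Import all_classical all_reals all_analysis.
From mathcomp Require Import lra.
Import Order.TTheory GRing.Theory Num.Theory.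
Import numFieldNormedType.Exports.
Local Open Scope classical_set_scope.
Local Open Scope ring_scope.

(** Everything rests on one fact: [tau] is continuous and [eps0] is its unit, so
    if [G] is weakly near [F] and [H] is weakly near [eps0], then [tau (G, H)]
    is near [F] at the continuity points of [F] ([triangle_near_unit]).
    Combined with the triangle inequality (N3) it yields two properties of the
    strong topology.
    - Applied to [F = nu p], it makes [q |-> nu q x] lower semicontinuous at [p]
      whenever [x] is a continuity point of [nu p].
    - Applied to [F = eps0], it makes the strong topology Hausdorff: if [r] is
      strongly near both [p] and [q], then [nu (p - q)] is near [eps0].

    Boundedness: if the functions [nu p], [p] in [A], do not tend to 1 uniformly,
    there are [e > 0] and [u n] in [A] with [nu (u n) n < 1 - e] for every [n].
    A subsequence converges strongly to some [p] in [A].  As the space is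
    characteristic, [nu p x > 1 - e / 2] at some continuity point [x] of [nu p],
    and by semicontinuity [nu (u n) x > 1 - e] for all large [n] in the
    subsequence, which is absurd once [n > x].  The probabilistic radius is a
    left limit of the pointwise infimum, so a uniform bound on [A] passes to it;
    that it belongs to [Delta_plus] is the general behaviour of left limits of
    bounded monotone functions.

    Closedness: a point of the closure of [A] is the strong limit of a sequence
    in [A], because the neighborhoods of radius [1 / (n + 1)] form a base.  Some
    subsequence converges in [A], and limits are unique. *)

(** * Left limits of bounded monotone functions *)

Lemma nondecreasing_left_limit_cvg {R : realType} (f : R -> R) (M r : R) :
    {homo f : x y / x <= y} -> (forall x, f x <= M) ->
  cvg (f t @[t --> r^'-]).
Proof.
move=> fh fM; apply: nondecreasing_at_left_is_cvgr; near=> x.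
  by move=> s t _ _; exact: fh.
by exists M => _ [t _ <-]; exact: fM.
Unshelve. all: by end_near. Qed.

Lemma le_left_limit {R : realType} (f : R -> R) (M s r : R) :
    {homo f : x y / x <= y} -> (forall x, f x <= M) -> s < r ->
  f s <= lim (f t @[t --> r^'-]).
Proof.
move=> fh fM sr.
apply: limr_ge; first exact: (nondecreasing_left_limit_cvg _ M).
near=> t; apply: fh; apply: ltW; near: t; exact: nbhs_left_gt.
Unshelve. all: by end_near. Qed.

Lemma left_limit_le {R : realType} (f : R -> R) (M r : R) :
    {homo f : x y / x <= y} -> (forall x, f x <= M) ->
  lim (f t @[t --> r^'-]) <= f r.
Proof.
move=> fh fM.
apply: limr_le; first exact: (nondecreasing_left_limit_cvg _ M).
by near=> t; apply: fh; near: t; exact: nbhs_left_le.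
Unshelve. all: by end_near. Qed.

Lemma left_limit_homo {R : realType} (f : R -> R) (M : R) :
    {homo f : x y / x <= y} -> (forall x, f x <= M) ->
  {homo (fun r => lim (f t @[t --> r^'-])) : x y / x <= y}.
Proof.
move=> fh fM x y; rewrite le_eqVlt => /predU1P[->//|xy].
by apply: (@le_trans _ _ (f x));
  [exact: left_limit_le fM|exact: le_left_limit fM xy].
Qed.

(** For [s < t < r] the left limit at [t] lies between [f s] and the left limit
    at [r], and [f s] is close to the latter once [s] is close to [r]. *)
Lemma left_limit_left_continuous {R : realType} (f : R -> R) (M r : R) :
    {homo f : x y / x <= y} -> (forall x, f x <= M) ->
  lim (f u @[u --> t^'-]) @[t --> r^'-] --> lim (f u @[u --> r^'-]).
Proof.
move=> fh fM; apply/cvgrPdist_lt => e e0.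
have [s [sr se]] : exists s, s < r /\ `|lim (f u @[u --> r^'-]) - f s| < e.
  apply: (@filter_ex _ (r^'-)).
  have /cvgrPdist_lt/(_ _ e0) fe : f t @[t --> r^'-] --> lim (f u @[u --> r^'-]).
    exact: (nondecreasing_left_limit_cvg _ M).
  by near=> s; split; near: s; [exact: nbhs_left_lt|exact: fe].
near=> t.
have tr : t <= r by near: t; exact: nbhs_left_le.
have st : s < t by near: t; exact: nbhs_left_gt.
have h1 := le_left_limit f M s t fh fM st.
have h2 : lim (f u @[u --> t^'-]) <= lim (f u @[u --> r^'-]).
  exact: (left_limit_homo f M).
by move: se; rewrite !ltr_norml => /andP[? ?]; apply/andP; split; lra.
Unshelve. all: by end_near. Qed.

(** * The probabilistic radius *)

Lemma inf_nu_le {R : realType} (V : pnSpace R) (A : set V) (p : V) (t : R) :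
  A p -> inf_nu A t <= pn_nu p t%:E.
Proof.
move=> Ap; apply: ge_inf; last by exists p.
by exists 0 => _ [q _ <-]; exact: Delta_plus_ge0 (distfP _) _.
Qed.

Lemma le_inf_nu {R : realType} (V : pnSpace R) (A : set V) (c t : R) :
  A !=set0 -> (forall p, A p -> c <= pn_nu p t%:E) -> c <= inf_nu A t.
Proof.
move=> [p Ap] cA; apply: lb_le_inf; first by exists (pn_nu p t%:E), p.
by move=> _ [q Aq <-]; exact: cA.
Qed.

Lemma inf_nu_homo {R : realType} (V : pnSpace R) (A : set V) :
  A !=set0 -> {homo inf_nu A : x y / x <= y}.
Proof.
move=> A0 x y xy; apply: le_inf_nu => // p Ap.
apply: (le_trans (inf_nu_le _ _ _ _ Ap)).
by apply: (Delta_plus_homo (distfP _)); rewrite lee_fin.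
Qed.

Lemma inf_nu_le1 {R : realType} (V : pnSpace R) (A : set V) (t : R) :
  A !=set0 -> inf_nu A t <= 1.
Proof.
move=> [p Ap]; apply: (le_trans (inf_nu_le _ _ _ _ Ap)).
exact: Delta_plus_le1 (distfP _) _.
Qed.

Lemma inf_nu_ge0 {R : realType} (V : pnSpace R) (A : set V) (t : R) :
  A !=set0 -> 0 <= inf_nu A t.
Proof.
by move=> A0; apply: le_inf_nu => // p _; exact: Delta_plus_ge0 (distfP _) _.
Qed.

Lemma prob_radius_Delta_plus {R : realType} (V : pnSpace R) (A : set V) :
  A !=set0 -> Delta_plus (prob_radius A).
Proof.
move=> A0; have fh := inf_nu_homo _ _ A0.
have f1 t : inf_nu A t <= 1 by exact: inf_nu_le1.
have L0 r : 0 <= lim (inf_nu A t @[t --> r^'-]).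
  apply: le_trans (le_left_limit _ _ (r - 1) _ fh f1 _); first exact: inf_nu_ge0.
  by rewrite gtrBl.
have L1 r : lim (inf_nu A t @[t --> r^'-]) <= 1.
  exact: le_trans (left_limit_le _ _ _ fh f1) _.
split => //=.
- by case.
- by case.
- case=> [x| |] [y| |] //=; rewrite ?lee_fin ?leey ?leeNy_eq //.
  exact: left_limit_homo f1 _ _.
- by move=> x; exact: left_limit_left_continuous f1.
- apply/eqP; rewrite eq_le L0 andbT.
  apply: (le_trans (left_limit_le _ _ _ fh f1)).
  have [p Ap] := A0; apply: (le_trans (inf_nu_le _ _ _ _ Ap)).
  by rewrite (Delta_plus_at0 (distfP _)).
Qed.

(** Passing to left limits only shifts the argument by an arbitrarily small
    amount, so a bound uniform over [A] at one point is inherited by the radius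
    everywhere to its right. *)
Lemma D_bounded_uniform {R : realType} (V : pnSpace R) (A : set V) :
    A !=set0 ->
    (forall e : R, 0 < e ->
      exists x : R, forall p, A p -> 1 - e <= pn_nu p x%:E) ->
  D_bounded A.
Proof.
move=> A0 hA; have RA := prob_radius_Delta_plus _ _ A0; split=> //.
apply/cvgrPdist_le => e e0; have [x xA] := hA e e0.
near=> t.
have xt : x < t by near: t; by apply: nbhs_pinfty_gt; exact: num_real.
have h1 : 1 - e <= inf_nu A x by exact: le_inf_nu.
have h2 : inf_nu A x <= prob_radius A t%:E.
  apply: le_left_limit xt; first exact: inf_nu_homo.
  by move=> ?; exact: inf_nu_le1.
have h3 := Delta_plus_le1 RA t%:E.
by rewrite ler_norml; apply/andP; split; lra.
Unshelve. all: by end_near. Qed.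

(** * Continuity of the triangle function at the unit *)

(** Since [eps0] is the unit, [tau (G, H)] is weakly close to [F] as soon as
    [G] is close to [F] and [H] to [eps0]. *)
Lemma triangle_near_unit {R : realType} (V : pnSpace R) (F : distf R) (x e : R) :
    continuity_point F x -> 0 < e ->
  exists B : set (distf R), nbhs F B /\ exists2 m : R, 0 < m &
    forall G H : distf R, B G -> 1 - m < H m%:E -> F x%:E - e < pn_tau V G H x%:E.
Proof.
move=> Fx e0; have := (pn_tauP V).2 (F, eps0 R).
move=> /(_ [set G | `|G x%:E - F x%:E| < e]).
rewrite /= (trianglef1 (pn_tauP V).1) => /(_ (weak_nbhs1 Fx e0)).
move=> [[B C] /= [FB e0C] BC]; exists B; split=> //.
have [m m0 mC] := nbhs_eps0 e0C; exists m => // G H GB Hm.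
have := BC (G, H) (conj GB (mC _ Hm)).
by rewrite /= ltr_norml => /andP[]; lra.
Qed.

Lemma strong_nbhdC {R : realType} (V : pnSpace R) (p q : V) (l : R) :
  strong_nbhd p l q <-> strong_nbhd q l p.
Proof. by rewrite /strong_nbhd /= -(pn_N2 (p - q)) opprB. Qed.

(** The triangle inequality for [q = (q - p) + p], with [nu (q - p)] close to
    the unit. *)
Lemma pn_nu_lower_semicontinuous {R : realType} (V : pnSpace R) (p : V)
    (x e : R) : continuity_point (pn_nu p) x -> 0 < e ->
  exists2 m : R, 0 < m &
    forall q, strong_nbhd p m q -> pn_nu p x%:E - e < pn_nu q x%:E.
Proof.
move=> px e0; have [B [pB [m m0 mB]]] := triangle_near_unit V _ _ _ px e0.
exists m => // q /strong_nbhdC qp.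
apply: lt_le_trans (mB _ _ (nbhs_singleton pB) qp) _.
by have := pn_N3 p (q - p) x%:E; rewrite [p + _]addrC subrK.
Qed.

Lemma eps0_continuity_point {R : realType} (x : R) :
  0 < x -> continuity_point (eps0 R) x.
Proof.
move=> x0; apply: cvg_near_cst; near=> t.
have t0 : 0 < t by near: t; exact: lt_nbhsr.
by rewrite /= /eps0_fun !lte_fin t0 x0.
Unshelve. all: by end_near. Qed.

(** The bound at [l] propagates to every [x >= l], so letting [l] tend to 0
    forces [F x = 1] at each [x > 0]. *)
Lemma distf_eps0P {R : realType} (F : distf R) :
  (forall l : R, 0 < l -> 1 - l < F l%:E) -> F = eps0 R.
Proof.
move=> Fl; apply: distf_eq => x; rewrite /= /eps0_fun.
have [x0|x0] := ltP 0%E x; apply/eqP; rewrite eq_le; apply/andP; split.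
- exact: Delta_plus_le1 (distfP _) _.
- apply/ler_addgt0Pl => e e0; rewrite -lerBlDl.
  have [l /andP[l0 le] lx] : exists2 l : R, 0 < l <= e & (l%:E <= x)%E.
    case: x x0 => [x|_|//]; last by exists e; rewrite ?e0 ?lexx ?leey.
    rewrite lte_fin => x0; exists (Num.min e x); rewrite ?lee_fin ?ge_min ?lexx ?orbT //.
    by rewrite lt_min e0 x0.
  have Fx : F l%:E <= F x by exact: (Delta_plus_homo (distfP _)).
  have := Fl l l0; rewrite /=; lra.
- by rewrite mulr0n -(Delta_plus_at0 (distfP F)); exact: (Delta_plus_homo (distfP _)).
- exact: Delta_plus_ge0 (distfP _) _.
Qed.

(** At each [l > 0], a point [r] near both [p] and [q] gives
    [nu (p - q) l > 1 - l] through [p - q = (p - r) + (r - q)]; the point [l] is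
    a continuity point of [eps0] precisely because [l] is not 0. *)
Lemma strong_hausdorff {R : realType} (V : pnSpace R) :
  hausdorff_space (strong V).
Proof.
move=> p q pq.
suff /pn_N1/eqP : pn_nu ((p : V) - (q : V)) = eps0 R.
  by rewrite subr_eq0 => /eqP.
apply: distf_eps0P => l l0.
have [B [eB [m m0 mB]]] :=
  triangle_near_unit V _ _ _ (eps0_continuity_point l l0) l0.
have [m' m'0 m'B] := nbhs_eps0 eB.
have pm' : nbhs p (strong_nbhd (p : V) m') by exists m'.
have qm : nbhs q (strong_nbhd (q : V) m) by exists m.
have [r [pr /strong_nbhdC rq]] := pq _ _ pm' qm.
have := mB _ _ (m'B _ pr) rq; rewrite /= /eps0_fun lte_fin l0 => h.
apply: lt_le_trans h _.
have := pn_N3 ((p : V) - r) (r - (q : V)) l%:E.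
by rewrite addrA subrK.
Qed.

(** * D-compact sets *)

Lemma subseq_ge_id (s : nat -> nat) :
  {homo s : m n / (m < n)%N} -> forall n, (n <= s n)%N.
Proof.
by move=> sh; elim=> // n /leq_ltn_trans; apply; exact: sh.
Qed.

(** A sequence whose [n]-th term has [nu] small at [n] cannot have a subsequence
    converging to a vector whose [nu] tends to 1. *)
Lemma D_compact_bounded {R : realType} (V : pnSpace R) (A : set V) :
  characteristic V -> A !=set0 -> D_compact A -> D_bounded A.
Proof.
move=> hchar A0 hA; apply: D_bounded_uniform => // e e0; apply: contrapT => nA.
have {nA} /choice[u uA] n : exists p : V, A p /\ pn_nu p n%:R%:E < 1 - e.
  apply: contrapT => nE; apply: nA; exists n%:R => p Ap.
  by rewrite leNgt; apply/negP => pn; apply: nE; exists p.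
have [s [p [sh Ap /cvg_strongP sp]]] := hA u (fun n => (uA n).1).
have e20 : 0 < e / 2 by rewrite divr_gt0.
have [y py] : exists y : R, 1 - e / 2 < pn_nu p y%:E.
  apply: (@filter_ex _ +oo).
  have /cvgrPdist_lt/(_ _ e20) := (hchar p).2.
  by apply: filterS => y; rewrite ltr_norml => /andP[]; lra.
have [x /andP[yx _] px] :=
  continuity_point_dense (pn_nu p) (ltac:(by rewrite ltrDl) : y < y + 1).
have [m m0 mp] := pn_nu_lower_semicontinuous V p x _ px e20.
have [N Np] := sp m m0.
have pyx : pn_nu p y%:E <= pn_nu p x%:E.
  by apply: (Delta_plus_homo (distfP _)); rewrite lee_fin ltW.
(* an index at which the subsequence is close to p and has outgrown x *)
pose n := maxn N (Num.truncn x).+1.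
have xn : x < (s n)%:R.
  apply: (lt_le_trans (truncnS_gt x)); rewrite ler_nat.
  by apply: leq_trans (subseq_ge_id _ sh n); exact: leq_maxr.
have h1 := mp _ (Np n (leq_maxl _ _)).
have h2 : pn_nu (u (s n)) x%:E <= pn_nu (u (s n)) (s n)%:R%:E.
  by apply: (Delta_plus_homo (distfP _)); rewrite lee_fin ltW.
have := (uA (s n)).2; lra.
Qed.

(** Sequential compactness suffices because the strong topology is first
    countable and Hausdorff. *)
Lemma D_compact_closed {R : realType} (V : pnSpace R) (A : set V) :
  D_compact A -> closed (A : set (strong V)).
Proof.
move=> hA p clAp.
have /choice[u uA] (n : nat) : exists q : V, A q /\ strong_nbhd (p : V) n.+1%:R^-1 q.
  have pn : nbhs p (strong_nbhd (p : V) n.+1%:R^-1).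
    by exists n.+1%:R^-1 => //=; rewrite invr_gt0.
  by have [q [Aq pq]] := clAp _ pn; exists q.
have [s [q [sh Aq sq]]] := hA u (fun n => (uA n).1).
suff sp : (u (s n) : strong V) @[n --> \oo] --> p.
  by rewrite (cvg_unique (@strong_hausdorff _ V) sp sq).
(* s n >= n >= truncn (1 / l) makes the radius 1 / (s n + 1) at most l *)
apply/cvg_strongP => l l0; exists (Num.truncn l^-1) => n ln.
apply: strong_nbhd_homo (uA (s n)).2.
rewrite -[leRHS]invrK lef_pV2 ?posrE ?invr_gt0 //.
apply: ltW; apply: (lt_le_trans (truncnS_gt _)); rewrite ler_nat ltnS.
exact: leq_trans ln (subseq_ge_id _ sh n).
Qed.

Theorem lemma2p4 (R : realType) (phi : \bar R -> \bar R) (hphi : Mtilde phi)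
    (V : pnSpace R) (hchar : characteristic V) (hV : phi_Serstnev phi V)
    (A : set V) (hA0 : A !=set0) (hA : D_compact A) :
  D_bounded A /\ closed (A : set (strong V)).
Proof. by split; [exact: D_compact_bounded|exact: D_compact_closed]. Qed.
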